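(* Let $p$ be a prime, let $G$ be a finite $p$-solvable group and let $P$ be a Sylow $p$-subgroup of $G$. Then for every $\chi\in\operatorname{Irr}(G)$ there exist a subgroup $Q\le P$ and a linear character $\lambda\in\operatorname{Irr}(Q)$ such that $\chi(1)_p=|P:Q|$ and $\lambda^P$ is a summand of $\chi_P$ (i.e. $\chi_P-\lambda^P$ is a character of $P$ or zero).
   Context: $\operatorname{Irr}(G)$ is the set of irreducible complex characters of $G$; a linear character is a character of degree $1$. $m_p$ denotes the $p$-part of a positive integer $m$, i.e. the largest power of $p$ dividing $m$. $\chi_P$ is the restriction of $\chi$ to $P$ and $\lambda^P$ is the character of $P$ induced from $\lambda$. *)

(* Defs.v *)
From mathcomp Require Import all_boot all_order all_fingroup all_algebra.
From mathcomp Require Import all_solvable all_field all_character.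

Set Implicit Arguments.
Unset Strict Implicit.
Unset Printing Implicit Defensive.

Import GroupScope.

(* A normal series of G: the terms are normal in G itself, not only in their *)
(* successors.                                                               *)
Definition p_solvable (p : nat) (gT : finGroupType) (G : {group gT}) : Prop :=
  exists s : seq {group gT},
    [/\ all (fun N : {group gT} => N <| G) s,
        path (fun H K : {group gT} =>
                (H \subset K) && (p.-group (K / H) || p^'.-group (K / H)))
             1%G s
      & last 1%G s = G].

(* Main.v *)
Require Import Defs.
From mathcomp Require Import all_boot all_order all_fingroup all_algebra.
From mathcomp Require Import all_solvable all_field all_character.
Import GroupScope Order.TTheory GRing.Theory Num.Theory.

(** The proof is an induction on the order of G, in two cases.

    If some constituent theta of the restriction of chi to a normal subgroup
    is not G-invariant, Clifford's correspondence gives chi = Ind psi for an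
    irreducible psi of the inertia group T < G of theta; conjugating theta
    makes P :&: T a Sylow p-subgroup of T.  The summand found for psi inside
    P :&: T is induced to P: the double coset of 1 in Mackey's formula shows
    that Ind (Res psi) is a summand of Res (Ind psi) (sub_Res_Ind_char), and
    the index of T contributes |P : P :&: T| to the p-part of the degree
    (monomial_summand_Ind).

    Otherwise chi is quasi-primitive, and it factors as chi = alpha * beta,
    where alpha behaves like a p-special character and beta like a p'-special
    one (special_factorization): alpha restricts irreducibly to P, hence has
    p-power degree, and beta has degree prime to p.  All irreducible degrees
    of P being powers of p, the restriction of beta to P has a linear
    constituent l.  Then delta := l * Res alpha is an irreducible constituent
    of the restriction of chi to P whose degree is exactly the p-part of that
    of chi.  When P < G the induction hypothesis for (P, delta) concludes; when
    P = G, a quasi-primitive character of a p-group is linear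
    (quasi_primitive_pgroup_lin), and Q = P does.

    The factorization is carried up the normal series, from N to M, with
    theta = alpha * beta a G-invariant constituent on N.  If M / N is a
    p-group, beta has degree and determinantal order coprime to |M : N|, so it
    has a unique extension beta' of the same determinantal order
    (extend_coprime_irr); the characters of M over theta are then the products
    of beta' with those over alpha, in a one-to-one way, so the constituent on
    M factors, and uniqueness makes both factors G-invariant.  The factor over
    alpha is again irreducible on P :&: M, because M = N (P :&: M)
    (constt_Res_irr_supplement).  If M / N is a p'-group, the roles of p and p'
    are exchanged, with a Hall p'-subgroup in place of P.  As M / N need not be
    solvable in that case, extensions are built directly: intertwining
    matrices form a projective representation, whose cohomology class is killed
    by both the degree and the index. *)

Set Implicit Arguments.
Unset Strict Implicit.
Unset Printing Implicit Defensive.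

Local Open Scope ring_scope.

(** * Extending invariant characters with coprime index *)

Section Extension.

Variables (gT : finGroupType) (G N : {group gT}).
Hypothesis nsNG : N <| G.
Variables (n : nat) (rN : mx_representation algC N n).
Variable mu : 'CF(G).
Hypothesis lin_mu : mu \is a linear_char.
Hypothesis det_rN : {in N, forall x, \det (rN x) = mu x}.

Let sNG : N \subset G. Proof. exact: normal_sub. Qed.
Let nNG : G \subset 'N(N). Proof. exact: normal_norm. Qed.
Let memJ x g : g \in G -> (x ^ g \in N)%g = (x \in N).
Proof. by move=> Gg; rewrite memJ_norm // (subsetP nNG). Qed.

(** Invariance makes rN similar to its conjugate by g, and rescaling gives the
    intertwiner any nonzero determinant.  Fixing it as mu g, with mu
    multiplicative, is what later makes the cocycle of these matrices take its
    values in the n-th roots of unity. *)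
Lemma intertwiner_with_det (g : gT) :
    (0 < n)%N -> g \in G -> G \subset 'I[cfRepr rN] ->
  exists D : 'M[algC]_n, \det D = mu g /\
    {in N, forall x, rN x *m D = D *m rN (x ^ g)%g}.
Proof.
move=> n_gt0 Gg IG.
pose rJ x := rN (x ^ g)%g.
have rJP : mx_repr N rJ.
  split=> [|x y Nx Ny]; rewrite /rJ ?conj1g ?repr_mx1 //.
  by rewrite conjMg repr_mxM ?memJ.
pose rNg := MxRepresentation rJP.
have /cfRepr_rsimP[B _ freeB simB]: cfRepr rN == cfRepr rNg.
  apply/eqP/cfun_inP=> x Nx.
  by rewrite -(inertia_valJ x (subsetP IG g Gg)) !cfunE memJ // Nx.
have nz_det : \det B != 0 by rewrite -unitfE -[_ \is a _]row_free_unit.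
pose c := n.-root (mu g / \det B).
exists (c *: B); split=> [|x Nx]; last first.
  by rewrite -scalemxAr -scalemxAl simB.
by rewrite detZ rootCK // divfK.
Qed.

(** Choosing the matrices on representatives of the cosets of N, and
    translating by rN, makes the cocycle of the family depend only on cosets. *)
Lemma intertwiner_family :
    (0 < n)%N -> G \subset 'I[cfRepr rN] ->
  exists D : gT -> 'M[algC]_n,
    [/\ {in G, forall g, \det (D g) = mu g},
        {in G & N, forall g x, rN x *m D g = D g *m rN (x ^ g)%g}
      & {in G & N, forall g x, D (x * g)%g = rN x *m D g}].
Proof.
move=> n_gt0 IG.
have /fin_all_exists[D0 D0P] (g : gT) : exists D : 'M[algC]_n, g \in G ->
    \det D = mu g /\ {in N, forall x, rN x *m D = D *m rN (x ^ g)%g}.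
  case Gg: (g \in G); last by exists 0.
  by have [D DP] := intertwiner_with_det n_gt0 Gg IG; exists D.
pose r (g : gT) := repr (N :* g)%g.
have rP g : g \in G -> exists2 y, y \in N & (r g = y * g)%g /\ r g \in G.
  move=> Gg; have /rcosetP[y Ny Dr] := mem_repr_rcoset N g.
  by exists y => //; rewrite /r Dr groupM // (subsetP sNG).
exists (fun g => rN (g * (r g)^-1)%g *m D0 (r g)).
split=> [g | g x | g x] Gg.
- have [y Ny [Dr Gr]] := rP g Gg; have [detD _] := D0P _ Gr.
  have Ngr: (g * (r g)^-1)%g \in N by rewrite Dr invMg mulKVg groupV.
  have Gz := subsetP sNG _ Ngr.
  by rewrite det_mulmx detD det_rN // -(lin_charM lin_mu) ?mulgKV.
- move=> Nx; have [y Ny [Dr Gr]] := rP g Gg; have [_ DJ] := D0P _ Gr.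
  have: (g * (r g)^-1)%g \in N by rewrite Dr invMg mulKVg groupV.
  have ->: (x ^ g = (x ^ (g * (r g)^-1)) ^ r g)%g by rewrite -conjgM mulgKV.
  move: (g * _)%g => z Nz.
  rewrite mulmxA -repr_mxM // conjgC repr_mxM ?groupJ //.
  by rewrite -!mulmxA DJ ?groupJ.
move=> Nx; have -> : r (x * g)%g = r g by rewrite /r rcosetM (rcoset_id Nx).
have [y Ny [Dr Gr]] := rP g Gg.
have Ngr: (g * (r g)^-1)%g \in N by rewrite Dr invMg mulKVg groupV.
by rewrite mulmxA -repr_mxM // mulgA.
Qed.

(** The matrices D multiply up to scalars: D g *m D h = a g h *: D (g * h), with
    a a 2-cocycle of G / N.  Taking determinants, a g h is an n-th root of
    unity.  Multiplying the cocycle identity over the last variable shows that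
    the #|G : N|-th power of a is the coboundary of A.  As n and #|G : N| are
    coprime, a itself is a coboundary, and rescaling D by a power of A yields a
    representation. *)
Lemma repr_extension_of_intertwiners (D : gT -> 'M[algC]_n) :
    mx_absolutely_irreducible rN -> coprime #|G : N| n ->
    {in G, forall g, \det (D g) = mu g} ->
    {in G & N, forall g x, rN x *m D g = D g *m rN (x ^ g)%g} ->
    {in G & N, forall g x, D (x * g)%g = rN x *m D g} ->
  exists rG : mx_representation algC G n, {in N, forall x, rG x = rN x}.
Proof.
move=> absN co_n detD DJ DM.
have uD g : g \in G -> D g \in unitmx.
  by move=> Gg; rewrite unitmxE detD // unitfE lin_char_neq0.
pose E g h := D g *m D h *m invmx (D (g * h)%g).
have E_scalar g h : g \in G -> h \in G -> is_scalar_mx (E g h).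
  move=> Gg Gh; apply: (mx_abs_irr_cent_scalar absN).
  apply/centgmxP=> x Nx; have Ggh := groupM Gg Gh.
  have DDJ : rN x *m (D g *m D h) = D g *m D h *m rN (x ^ (g * h))%g.
    by rewrite mulmxA DJ // -[LHS]mulmxA DJ ?memJ // mulmxA conjgM.
  rewrite /E [RHS]mulmxA DDJ -!mulmxA; congr (_ *m (_ *m _)).
  apply: (can_inj (mulKmx (uD _ Ggh))).
  by rewrite [RHS]mulmxA -DJ // mulmxK ?mulKVmx ?uD.
have n_gt0 : (0 < n)%N by case/andP: absN.
have not_unit0 : (0 : 'M[algC]_n) \notin unitmx.
  by rewrite unitmxE; case: (n) n_gt0 => // k _; rewrite det0 unitr0.
pose i0 : 'I_n := Ordinal n_gt0.
pose a g h := E g h i0 i0.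
have aP g h : g \in G -> h \in G -> D g *m D h = a g h *: D (g * h)%g.
  move=> Gg Gh; have /is_scalar_mxP[c Ec] := E_scalar g h Gg Gh.
  rewrite /a Ec !mxE eqxx -mul_scalar_mx -Ec /E mulmxKV ?uD ?groupM //.
have a_unique g h c : g \in G -> h \in G ->
    D g *m D h = c *: D (g * h)%g -> a g h = c.
  move=> Gg Gh; rewrite aP // => /eqP; rewrite -subr_eq0 -scalerBl scaler_eq0.
  case/orP=> [|/eqP D0]; first by rewrite subr_eq0 => /eqP.
  by have := uD _ (groupM Gg Gh); rewrite D0 (negPf not_unit0).
have aNl g h x : g \in G -> h \in G -> x \in N -> a (x * g)%g h = a g h.
  move=> Gg Gh Nx; have Gx := subsetP sNG x Nx.
  apply: a_unique; rewrite ?groupM // (DM g x) // -mulmxA aP // -mulgA.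
  by rewrite (DM (g * h)%g x) ?groupM // scalemxAr.
have aNr g h x : g \in G -> h \in G -> x \in N -> a g (x * h)%g = a g h.
  move=> Gg Gh Nx; have Gx := subsetP sNG x Nx.
  have Nx' : (x ^ g^-1)%g \in N by rewrite memJ ?groupV.
  apply: a_unique; rewrite ?groupM // (DM h x) // mulmxA.
  rewrite -[x in rN x](conjgKV g) -DJ // -mulmxA aP // -scalemxAr.
  rewrite -(DM _ _ (groupM Gg Gh) Nx').
  by rewrite conjgE invgK !mulgA mulgKV.
have a_neq0 g h : g \in G -> h \in G -> a g h != 0.
  move=> Gg Gh; apply/eqP=> a0; have := unitmx_mul (D g) (D h).
  by rewrite !uD // aP // a0 scale0r (negPf not_unit0).
have a_n g h : g \in G -> h \in G -> a g h ^+ n = 1.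
  move=> Gg Gh; have := congr1 determinant (aP g h Gg Gh).
  rewrite det_mulmx detZ !detD ?groupM // (lin_charM lin_mu) //.
  have nz : mu g * mu h != 0 by rewrite mulf_neq0 ?lin_char_neq0.
  by move/(canLR (mulfK nz)); rewrite divff.
have cocycle g h k : g \in G -> h \in G -> k \in G ->
    a g h * a (g * h)%g k = a h k * a g (h * k)%g.
  move=> Gg Gh Gk.
  have: D g *m D h *m D k = D g *m (D h *m D k) by rewrite mulmxA.
  rewrite (aP g h) // (aP h k) // -scalemxAl -scalemxAr !aP ?groupM //.
  rewrite !scalerA mulgA => /eqP; rewrite -subr_eq0 -scalerBl scaler_eq0.
  case/orP=> [|/eqP D0]; first by rewrite subr_eq0 => /eqP.
  have := uD _ (groupM (groupM Gg Gh) Gk); rewrite D0.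
  by rewrite (negPf not_unit0).
have reprP u : u \in (G / N)%g -> repr u \in G /\ coset N (repr u) = u.
  move=> Gu; rewrite coset_reprK; split=> //.
  case/morphimP: Gu => y Ny Gy ->; rewrite val_coset //.
  by case: repr_rcosetP => x Nx; rewrite groupM // (subsetP sNG).
pose A g := \prod_(u in (G / N)%g) a g (repr u).
have A_shift g h : g \in G -> h \in G ->
    \prod_(u in (G / N)%g) a g (h * repr u)%g = A g.
  move=> Gg Gh; have Nh := subsetP nNG h Gh.
  have Gch : coset N h \in (G / N)%g by rewrite mem_quotient.
  rewrite [RHS](reindex_inj (mulgI (coset N h))) /=.
  apply: eq_big => [u | u Gu]; first by rewrite groupMl.
  have [Gr Dr] := reprP u Gu.
  have [Gr1 Dr1] := reprP _ (groupM Gch Gu).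
  have /rcosetP[x Nx ->]: (h * repr u)%g \in (N :* repr (coset N h * u)%g)%g.
    apply/rcoset_kercosetP; rewrite ?(subsetP nNG) ?groupM //.
    by rewrite Dr1 morphM ?(subsetP nNG) //= Dr.
  by rewrite aNr.
have A_mul g h : g \in G -> h \in G ->
    A g * A h = a g h ^+ #|G : N| * A (g * h)%g.
  move=> Gg Gh; rewrite -(A_shift g h) // -big_split /= -card_quotient //.
  rewrite -prodr_const -big_split /=; apply: eq_bigr => u Gu.
  by have [Gr _] := reprP u Gu; rewrite cocycle // mulrC.
have A_neq0 g : g \in G -> A g != 0.
  by move=> Gg; apply/prodf_neq0=> u /reprP[Gr _]; apply: a_neq0.
have A_N x : x \in N -> A x = A 1%g.
  move=> Nx; apply: eq_bigr => u /reprP[Gr _].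
  by rewrite -[x]mulg1 aNl.
(* Bezout: s * #|G : N| = t * n + 1. *)
have [s t Dst _] := egcdnP n (indexg_gt0 G N).
rewrite (eqP co_n) in Dst.
pose F g := A g ^- s *: D g.
have FM g h : g \in G -> h \in G -> F (g * h)%g = F g *m F h.
  move=> Gg Gh; rewrite /F -scalemxAl -scalemxAr aP // !scalerA.
  have a_split : A g ^+ s * A h ^+ s = a g h * A (g * h)%g ^+ s.
    rewrite -exprMn A_mul // exprMn -exprM mulnC Dst exprD mulnC exprM a_n //.
    by rewrite expr1n mul1r.
  congr (_ *: _); rewrite -invfM mulrC a_split invfM mulrA divff ?a_neq0 //.
  by rewrite mul1r.
have F_N x : x \in N -> F x = rN x *m F 1%g.
  by move=> Nx; rewrite /F A_N // -[x in D x]mulg1 DM // scalemxAr.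
have F1 : F 1%g = 1%:M.
  have uF1 : F 1%g \in unitmx.
    by rewrite unitmxZ ?uD // unitfE invr_eq0 expf_neq0 ?A_neq0.
  by apply: (can_inj (mulKmx uF1)); rewrite mulmx1 -FM // mulg1.
have FP : mx_repr G F by [].
by exists (MxRepresentation FP) => x Nx; rewrite /= F_N // F1 mulmx1.
Qed.

End Extension.

(** The analogue, for arbitrary quotients G / N, of the extension criterion
    [solvable_irr_extendible_from_det]. *)
Lemma irr_extendible_from_det (gT : finGroupType) (G N : {group gT})
    (t : Iirr N) (mu : 'CF(G)) (theta := 'chi_t) :
    N <| G -> G \subset 'I[theta] ->
    coprime #|G : N| (Num.truncn (theta 1%g)) ->
    mu \is a linear_char -> 'Res[N] mu = cfDet theta ->
  exists c, 'Res 'chi[G]_c = theta.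
Proof.
move=> nsNG IGth co_n lin_mu mu_N.
have sNG := normal_sub nsNG; pose rN := 'Chi_t.
have absN : mx_absolutely_irreducible rN.
  by apply: groupC (socle_irr _).
have Dth : cfRepr rN = theta by apply: irrRepr.
have det_rN : {in N, forall x, \det (rN x) = mu x}.
  move=> x Nx; rewrite -(cfResE mu sNG Nx) mu_N -Dth cfDetRepr cfunE Nx mulr1n.
  by rewrite mxtrace_scalar mulr1n.
have n_gt0 := irr_degree_gt0 (socle_of_Iirr t).
rewrite -Dth in IGth.
have [D [detD DJ DM]] := intertwiner_family nsNG lin_mu det_rN n_gt0 IGth.
rewrite irr1_degree natrK in co_n.
have [rG rG_N] :=
  repr_extension_of_intertwiners nsNG lin_mu absN co_n detD DJ DM.
have Res_rG : 'Res[N] (cfRepr rG) = theta.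
  apply/cfun_inP=> x Nx; rewrite cfResE // -Dth !cfunE Nx (subsetP sNG) //.
  by rewrite rG_N.
have /irrP[c Dc] : cfRepr rG \in irr G.
  by apply: (@cfRes_irr_irr _ G N); rewrite ?cfRepr_char // Res_rG mem_irr.
by exists c; rewrite -Dc.
Qed.

(** Coprimeness makes the determinant of theta extend canonically to G, hence
    theta extends, and an extension is pinned down by its determinant.
    The uniqueness clause is what transfers invariance from theta to its
    extension. *)
Lemma extend_coprime_irr (gT : finGroupType) (G N : {group gT}) (t : Iirr N)
    (theta := 'chi_t) :
    N <| G -> G \subset 'I[theta] ->
    coprime #|G : N| ('o(theta)%CF * Num.truncn (theta 1%g)) ->
  exists c, [/\ 'Res 'chi[G]_c = theta, 'o('chi_c)%CF = 'o(theta)%CF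
              & forall d, 'Res 'chi_d = theta ->
                  coprime #|G : N| 'o('chi_d)%CF -> d = c].
Proof.
move=> nsNG IGth; rewrite coprimeMr => /andP[co_o co_n].
have lin_det : cfDet theta \is a linear_char := cfDet_lin_char theta.
have IGdet : G \subset 'I[cfDet theta].
  apply/subsetP=> y /(subsetP IGth)/setIdP[nNy /eqP th_y].
  by rewrite inE nNy /= -cfDetConjg th_y.
have co_det : coprime #|G : N| 'o(cfDet theta)%CF by rewrite cfDet_order_lin.
have [u [Res_u o_u u_unique]] :=
  extend_coprime_linear_char nsNG lin_det IGdet co_det.
have lin_u : 'chi_u \is a linear_char.
  by apply: (@cfRes_lin_lin _ G N); rewrite ?irr_char // Res_u.
have [c0 Res_c0] := irr_extendible_from_det nsNG IGth co_n lin_u Res_u.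
have [c [Res_c det_c] c_unique] := extend_to_cfdet nsNG co_n Res_c0 Res_u.
exists c; split=> // [|d Res_d co_d].
  by rewrite !cfDet_order_lin // -det_c in o_u.
have lin_d : cfDet 'chi_d \is a linear_char := cfDet_lin_char 'chi_d.
have /irrP[v Dv] := lin_char_irr lin_d.
have co_v : coprime #|G : N| 'o('chi_v)%CF by rewrite -Dv cfDet_order_lin.
have Dvu : v = u by apply: u_unique; rewrite // -Dv -cfDetRes ?irr_char ?Res_d.
by apply: c_unique; rewrite // Dv Dvu.
Qed.

(** * Restricting induced characters *)

Lemma sub_char_ge0 (gT : finGroupType) (G : {group gT}) (phi psi : 'CF(G)) :
    phi \is a character -> psi \is a character ->
    (forall i, '[psi, 'chi_i] <= '[phi, 'chi_i]) ->
  phi - psi \is a character.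
Proof.
move=> Nphi Npsi le_psi_phi.
rewrite [phi - psi]cfun_sum_cfdot rpred_sum // => i _.
have /natrP[m ->] : '[phi - psi, 'chi_i] \in Num.nat.
  rewrite natrEint cfdotBl subr_ge0 le_psi_phi andbT rpredB //.
    by rewrite intr_nat ?Cnat_cfdot_char_irr.
  by rewrite intr_nat ?Cnat_cfdot_char_irr.
by rewrite scaler_nat rpredMn ?irr_char.
Qed.

(** Up to the order of U = P :&: T :^ y^-1, the sum is the scalar product over U
    of mu with the character x |-> psi (x ^ y): the contribution of the double
    coset of y to Mackey's formula. *)
Lemma sum_conj_char_ge0 (gT : finGroupType) (P T : {group gT})
    (psi : 'CF(T)) (mu : 'CF(P)) (y : gT) :
    psi \is a character -> mu \is a character ->
  0 <= \sum_(x in P) psi (x ^ y)%g * (mu x)^*.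
Proof.
move=> Npsi Nmu; pose U := (P :&: T :^ y^-1)%G.
have Uy x : x \in U -> (x ^ y)%g \in T.
  by rewrite inE => /andP[_]; rewrite mem_conjg invgK.
pose f := conjgm_morphism U y.
have sfU : f @* U \subset T.
  by apply/subsetP=> _ /morphimP[x Ux _ ->]; apply: Uy.
pose psiU : 'CF(U) := cfMorph ('Res[f @* U] psi).
have psiUE x : x \in U -> psiU x = psi (x ^ y)%g.
  by move=> Ux; rewrite cfMorphE // cfResE // mem_morphim.
have NpsiU : psiU \is a character by rewrite cfMorph_char ?cfRes_char.
have NmuU : 'Res[U] mu \is a character by rewrite cfRes_char.
have := natr_ge0 (Cnat_cfdot_char NpsiU NmuU).
rewrite cfdotE pmulr_rge0 ?invr_gt0 ?gt0CG //.
suffices -> : \sum_(x in P) psi (x ^ y)%g * (mu x)^*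
            = \sum_(x in U) psiU x * (('Res[U] mu) x)^* by [].
rewrite [LHS](big_setID (T :^ y^-1)%g) /= [X in _ + X]big1 ?addr0.
  apply: eq_bigr => x Ux; have /setIP[Px _] := Ux.
  by rewrite psiUE // cfResE ?subsetIl.
move=> x /setDP[_]; rewrite mem_conjg invgK => notTx.
by rewrite (cfun0 psi) ?mul0r.
Qed.

(** In Mackey's formula for Res (Ind psi), the double coset of 1 contributes
    Ind (Res psi) and the others contribute characters.  Only signs of scalar
    products with irreducible characters mu matter: |P| |T| times the scalar
    product of Res (Ind psi) with mu is a sum over y in G of terms f y >= 0,
    and f is constant on P * T. *)
Lemma sub_Res_Ind_char (gT : finGroupType) (G P T : {group gT}) (psi : 'CF(T)) :
    P \subset G -> T \subset G -> psi \is a character ->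
  'Res[P] ('Ind[G] psi) - 'Ind[P] ('Res[P :&: T] psi) \is a character.
Proof.
move=> sPG sTG Npsi; have sSP := subsetIl P T.
apply: sub_char_ge0 => [||i].
- by rewrite cfRes_char ?cfInd_char.
- by rewrite cfInd_char ?cfRes_char.
pose mu := 'chi_i; pose f y := \sum_(x in P) psi (x ^ y)%g * (mu x)^*.
have f_ge0 y : 0 <= f y by apply: sum_conj_char_ge0 (irr_char i).
have f_const p t : p \in P -> t \in T -> f (p * t)%g = f 1%g.
  move=> Pp Tt; rewrite /f.
  rewrite [RHS](reindex_astabs 'J p) ?astabsJ ?(subsetP (normG P)) //=.
  apply: eq_bigr => x Px; rewrite conjgM conjg1 (cfunJ psi) // (cfunJ mu) //.
have -> : '['Ind[P] ('Res[P :&: T] psi), mu] = #|P :&: T|%:R^-1 * f 1%g.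
  rewrite -cfdot_Res_r cfdotE; congr (_ * _).
  rewrite /f [RHS](big_setID T) /= [X in _ + X]big1 ?addr0.
    apply: eq_bigr => x Sx; have /setIP[Px _] := Sx.
    by rewrite conjg1 !cfResE ?subsetIl ?subsetIr.
  by move=> x /setDP[_ notTx]; rewrite conjg1 (cfun0 psi) ?mul0r.
have -> : '['Res[P] ('Ind[G] psi), mu] =
          (#|P| * #|T|)%:R^-1 * \sum_(y in G) f y.
  rewrite natrM invfM cfdotE -mulrA; congr (_ * _).
  rewrite exchange_big mulr_sumr; apply: eq_bigr => x Px.
  by rewrite cfResE // cfIndE // -mulr_suml mulrA.
have sPTG : (P * T)%g \subset G by rewrite mul_subG.
rewrite (big_setID (P * T)%g) /= (setIidPr sPTG).
rewrite (eq_bigr (fun=> f 1%g)); last first.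
  by move=> _ /mulsgP[p t Pp Tt ->]; apply: f_const.
rewrite sumr_const -[f 1%g *+ _]mulr_natl mul_cardG natrM invfM mulrDr.
rewrite [X in _ <= X + _]mulrACA mulVf; last first.
  rewrite pnatr_eq0 -lt0n; apply/card_gt0P.
  by exists 1%g; rewrite -[1%g]mulg1 mem_mulg.
rewrite mul1r lerDl mulr_ge0 ?mulr_ge0 ?invr_ge0 ?ler0n // sumr_ge0 //.
Qed.

Lemma char1_ge_cfdot (gT : finGroupType) (G : {group gT}) (phi : 'CF(G)) i :
  phi \is a character -> '[phi, 'chi_i] * 'chi_i 1%g <= phi 1%g.
Proof.
move=> Nphi; rewrite {2}[phi]cfun_sum_cfdot sum_cfunE (bigD1 i) //= cfunE lerDl.
apply: sumr_ge0 => j _; rewrite cfunE mulr_ge0 ?char1_ge0 ?irr_char //.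
by rewrite natr_ge0 ?Cnat_cfdot_char_irr.
Qed.

Lemma char_sub1_eq (gT : finGroupType) (G : {group gT}) (phi psi : 'CF(G)) :
  phi - psi \is a character -> phi 1%g = psi 1%g -> phi = psi.
Proof.
move=> Nsub eq1; apply/eqP; rewrite -subr_eq0 -char1_eq0 //.
by rewrite !cfunE eq1 subrr.
Qed.

(** There is a single double coset, as the equality of degrees shows. *)
Lemma Res_Ind_mul (gT : finGroupType) (M N H : {group gT}) (phi : 'CF(N)) :
    N \subset M -> H \subset M -> (N * H)%g = M -> phi \is a character ->
  'Res[H] ('Ind[M] phi) = 'Ind[H] ('Res[H :&: N] phi).
Proof.
move=> sNM sHM defM Nphi; apply: char_sub1_eq (sub_Res_Ind_char sHM sNM Nphi) _.
rewrite cfRes1 !cfInd1 ?subsetIl // cfRes1.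
by rewrite indexgI -[in RHS]indexMg defM.
Qed.

Lemma Res_invariant_constt (gT : finGroupType) (M N : {group gT})
    (t : Iirr N) (c : Iirr M) :
    N <| M -> M \subset 'I['chi_t] -> t \in irr_constt ('Res[N] 'chi_c) ->
  'Res[N] 'chi_c = '['Res[N] 'chi_c, 'chi_t] *: 'chi_t.
Proof.
move=> nsNM IMt ct; rewrite {1}(Clifford_Res_sum_cfclass nsNM ct).
by rewrite cfclass_invariant // big_seq1.
Qed.

(** Write e for the multiplicity of theta = 'chi_t in Res 'chi_c, and let
    'chi_j be a constituent of the restriction of 'chi_c to H.  As
    Res (Ind theta) = Ind (Res theta) on H, the irreducible character Res theta
    of H :&: N occurs at least e times in the restriction of 'chi_j, so that
    the degree of 'chi_j is at least e * theta 1 = 'chi_c 1. *)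
Lemma constt_Res_irr_supplement (gT : finGroupType) (M N H : {group gT})
    (t : Iirr N) (c : Iirr M) :
    N <| M -> H \subset M -> (N * H)%g = M -> M \subset 'I['chi_t] ->
    c \in irr_constt ('Ind[M] 'chi_t) ->
    'Res[H :&: N] 'chi_t \in irr (H :&: N)%g ->
  'Res[H] 'chi_c \in irr H.
Proof.
move=> nsNM sHM defM IMt cM /irrP[b Db].
have sNM := normal_sub nsNM.
pose e := '['Res[N] 'chi_c, 'chi_t].
have Res_c : 'Res[N] 'chi_c = e *: 'chi_t.
  by apply: Res_invariant_constt => //; rewrite -constt_Ind_Res.
have Nres : 'Res[H] 'chi_c \is a character by rewrite cfRes_char ?irr_char.
have [j cj] := constt_cfRes_irr H c.
have [psi Npsi Dres] := constt_charP j Nres cj.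
have Ne : e \in Num.nat by rewrite Cnat_cfdot_char ?cfRes_char ?irr_char.
have Nj : 'Ind[M] 'chi_j \is a character by rewrite cfInd_char ?irr_char.
have le_e : e <= '['Res[H :&: N] 'chi_j, 'chi_b].
  rewrite -Db cfdot_Res_l -(Res_Ind_mul sNM) ?irr_char // cfdot_Res_r.
  rewrite cfdot_char_r ?cfInd_char ?irr_char // (bigD1 c) //=.
  have -> : '['Ind[M] 'chi_t, 'chi_c] = e.
    by rewrite -cfdot_Res_r cfdotC conj_natr.
  rewrite ler_wpDr //.
    apply: sumr_ge0 => i _.
    by rewrite natr_ge0 // rpredM // Cnat_cfdot_char_irr ?cfInd_char ?irr_char.
  rewrite ler_peMl ?natr_ge0 // -cfdot_Res_r.
  have /natrP[m Dm] : '['chi_j, 'Res[H] 'chi_c] \in Num.nat.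
    by rewrite Cnat_cfdot_char ?irr_char.
  move: cj; rewrite irr_consttE cfdotC Dm conj_natr // ler1n pnatr_eq0 lt0n.
  by [].
suffices psi0 : psi = 0 by rewrite Dres psi0 addr0 mem_irr.
have Dc1 : 'chi_c 1%g = 'chi_j 1%g + psi 1%g by rewrite -(cfRes1 H) Dres !cfunE.
have Db1 : 'chi_b 1%g = 'chi_t 1%g by rewrite -Db cfRes1.
have Dct1 : 'chi_c 1%g = e * 'chi_t 1%g by rewrite -(cfRes1 N) Res_c cfunE.
apply/eqP; rewrite -char1_eq0 // eq_le char1_ge0 // andbT.
rewrite -(lerD2l ('chi_j 1%g)) addr0 -Dc1 Dct1 -(cfRes1 (H :&: N) 'chi_j).
apply: le_trans (char1_ge_cfdot b (cfRes_char _ (irr_char j))).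
by rewrite Db1 ler_pM2r ?irr1_gt0.
Qed.

(** * Special characters *)

Section PiSpecial.

Variable gT : finGroupType.
Implicit Types G H K M N : {group gT}.

(** A stand-in, relative to G, for the pi-special characters of Gajendragadkar,
    where H is a Hall pi-subgroup of G and N is normal in G.  The irreducibility
    of the restriction to H :&: N, a theorem for pi-special characters,
    replaces the conditions on determinantal orders over subnormal subgroups:
    it passes up a normal series and bounds the degree. *)
Definition pi_special (pi : nat_pred) G H N (phi : 'CF(N)) :=
  [/\ phi \in irr N, G \subset 'I[phi], pi.-nat 'o(phi)%CF
    & 'Res[H :&: N] phi \in irr (H :&: N)%g].

Lemma pi_special_cfun1 pi G H : pi_special pi G H (1 : 'CF(1%g : {set gT})).
Proof.
split; rewrite ?cfun1_irr //.
- by rewrite inertia1 norms1.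
- rewrite cfDet_order_lin ?cfun1_lin_char //.
  suffices -> : #[1 : 'CF(1%g : {set gT})]%CF = 1%N by [].
  by apply/eqP; rewrite -dvdn1 dvdn_cforder expr1n.
- by rewrite rmorph1 cfun1_irr.
Qed.

Lemma pi_specialNK pi G H N (phi : 'CF(N)) :
  pi_special pi^'^' G H phi -> pi_special pi G H phi.
Proof. by case=> irr_phi IGphi; rewrite pnatNK. Qed.

Lemma pHallNK pi G H : pi.-Hall(G) H -> pi^'^'.-Hall(G) H.
Proof. by rewrite /pHall /pgroup !pnatNK. Qed.

Lemma irr1_pnat (pi : nat_pred) H (phi : 'CF(H)) :
  pi.-group H -> phi \in irr H -> pi.-nat (Num.truncn (phi 1%g)).
Proof.
move=> piH /irrP[i ->]; apply: pnat_dvd piH.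
by have := dvd_irr1_cardG i; rewrite irr1_degree natrK dvdC_nat.
Qed.

Lemma pi_special_deg_pnat pi G H N (phi : 'CF(N)) :
  pi.-group H -> pi_special pi G H phi -> pi.-nat (Num.truncn (phi 1%g)).
Proof.
move=> piH [_ _ _ irrH]; rewrite -(cfRes1 (H :&: N)).
by apply: irr1_pnat irrH; apply: pgroupS piH; apply: subsetIl.
Qed.

(** The determinant of 'chi_c restricts to N as a power of the determinant of
    'chi_t, so its 'o('chi_t)-th power is a character of M / N. *)
Lemma cfDet_order_dvd_constt_Ind M N (t : Iirr N) (c : Iirr M) :
    N <| M -> M \subset 'I['chi_t] -> c \in irr_constt ('Ind[M] 'chi_t) ->
  ('o('chi_c)%CF %| 'o('chi_t)%CF * #|M : N|)%N.
Proof.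
move=> nsNM IMt cM; have sNM := normal_sub nsNM.
set e := '['Res[N] 'chi_c, 'chi_t].
have Res_c : 'Res[N] 'chi_c = e *: 'chi_t.
  by apply: Res_invariant_constt => //; rewrite -constt_Ind_Res.
have /natrP[m Dm] : e \in Num.nat.
  by rewrite Cnat_cfdot_char ?cfRes_char ?irr_char.
pose mu := cfDet 'chi_c ^+ 'o('chi_t)%CF.
have lin_mu : mu \is a linear_char by rewrite rpredX ?cfDet_lin_char.
have kerN : N \subset cfker mu.
  rewrite -subsetIidl -cfker_Res ?lin_charW //.
  rewrite rmorphXn /= -cfDetRes ?irr_char // Res_c Dm scaler_nat.
  by rewrite cfDetMn ?irr_char // exprAC exp_cforder expr1n cfker_cfun1.
rewrite /cfDet_order dvdn_cforder exprM -/mu -dvdn_cforder.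
rewrite -(cfQuoK nsNM kerN) cforder_mod // -card_quotient ?normal_norm //.
by rewrite cforder_lin_char_dvdG ?cfQuo_lin_char.
Qed.

Lemma mul_setI_Hall pi G H M N :
    pi.-Hall(G) H -> M <| G -> N <| M -> pi.-group (M / N) ->
  (N * (H :&: M))%g = M.
Proof.
move=> hallH nsMG nsNM piMN; have [sNM nNM] := andP nsNM.
have hallHM := Hall_setI_normal nsMG hallH; have sHMM := subsetIr H M.
have nNHM := subset_trans sHMM nNM.
have := pHall_id (quotient_pHall nNHM hallHM) piMN.
move/(congr1 (fun A => coset N @*^-1 A)).
by rewrite /= (quotientGK nsNM) quotientK.
Qed.

Lemma pi_special_constt_Ind pi G H M N (t : Iirr N) (c : Iirr M) :
    pi.-Hall(G) H -> M <| G -> N <| M -> pi.-group (M / N) ->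
    pi_special pi G H 'chi_t -> c \in irr_constt ('Ind[M] 'chi_t) ->
    G \subset 'I['chi_c] ->
  pi_special pi G H 'chi_c.
Proof.
move=> hallH nsMG nsNM piMN [_ IGt o_t irr_t] cM IGc.
have [sMG _] := andP nsMG; have [sNM nNM] := andP nsNM.
have IMt := subset_trans sMG IGt.
split=> //; first exact: mem_irr.
  apply: pnat_dvd (cfDet_order_dvd_constt_Ind nsNM IMt cM) _.
  by rewrite pnatM o_t -card_quotient.
apply: (constt_Res_irr_supplement nsNM (subsetIr H M) _ IMt cM _).
  exact: (mul_setI_Hall hallH).
by rewrite /= -setIA (setIidPr sNM).
Qed.

(** When M / N is a pi^'-group, H meets M and N in the same subgroup, so an
    extension of 'chi_t to M inherits irreducibility on H :&: M. *)
Lemma pi_special_extension pi G H M N (t : Iirr N) :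
    pi.-Hall(G) H -> M <| G -> N <| G -> N \subset M -> pi^'.-group (M / N) ->
    pi_special pi G H 'chi_t ->
  exists2 c, 'Res[N, M] 'chi_c = 'chi_t & pi_special pi G H 'chi_c.
Proof.
move=> hallH nsMG nsNG sNM pi'MN spec_t; have [_ IGt o_t irr_t] := spec_t.
have [sMG nMG] := andP nsMG; have nsNM := normalS sNM sMG nsNG.
have nNM := normal_norm nsNM.
have piH := pHall_pgroup hallH; have t1 := pi_special_deg_pnat piH spec_t.
have co_t : coprime #|M : N| ('o('chi_t)%CF * Num.truncn ('chi_t 1%g)).
  by rewrite (p'nat_coprime (pi := pi)) ?pnatM ?o_t -?card_quotient.
have [c [Res_c o_c c_unique]] :=
  extend_coprime_irr nsNM (subset_trans sMG IGt) co_t.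
exists c => //; split; rewrite ?mem_irr ?o_c //.
  apply/subsetP=> g Gg; rewrite inE (subsetP nMG) //=; apply/eqP.
  rewrite -conjg_IirrE; congr ('chi_ _); apply: c_unique.
    rewrite conjg_IirrE -(cfConjgRes _ nsMG nsNG Gg) Res_c.
    by rewrite (inertiaJ (subsetP IGt g Gg)).
  rewrite conjg_IirrE /cfDet_order cfDetConjg.
  have -> : #[(cfDet 'chi_c ^ g)%CF]%CF = 'o('chi_c)%CF.
    apply: cforder_inj_rmorph; exact: can_inj (cfConjgK g).
  by rewrite o_c (p'nat_coprime (pi := pi)) -?card_quotient.
have sHMM := subsetIr H M.
have sHMN : H :&: M \subset N.
  rewrite -quotient_sub1 ?(subset_trans sHMM nNM) //; apply/trivgP.
  apply/card1_trivg/(@pnat_1 pi); last exact: pgroupS (quotientS N sHMM) pi'MN.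
  by apply: quotient_pgroup; apply: pgroupS piH; apply: subsetIl.
have eqHMN : H :&: M = H :&: N.
  by apply/eqP; rewrite eqEsubset [X in _ && X]setIS // subsetI subsetIl sHMN.
by rewrite -Res_c cfResRes ?subsetIr // -eqHMN in irr_t.
Qed.

(** The pi^'-special factor extends to M and the pi-special one is replaced by a
    constituent of its induced character.  Multiplication by the extension
    being injective on those constituents, G-invariance of the product
    'chi_c and of the extension forces that of the other factor. *)
Lemma pi_special_factor_step pi G H K M N (a b : Iirr N) (c : Iirr M) :
    pi.-Hall(G) H -> pi^'.-Hall(G) K -> M <| G -> N <| G -> N \subset M ->
    pi.-group (M / N) ->
    pi_special pi G H 'chi_a -> pi_special pi^' G K 'chi_b ->
    G \subset 'I['chi_c] -> 'chi_a * 'chi_b \in irr N ->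
    '['Res[N] 'chi_c, 'chi_a * 'chi_b] != 0 ->
  exists ab : Iirr M * Iirr M,
    [/\ pi_special pi G H 'chi_ab.1, pi_special pi^' G K 'chi_ab.2
      & 'chi_c = 'chi_ab.1 * 'chi_ab.2].
Proof.
move=> hallH hallK nsMG nsNG sNM piMN spec_a spec_b IGc irr_ab c_ab.
have [sMG nMG] := andP nsMG; have nsNM := normalS sNM sMG nsNG.
have pi''MN : pi^'^'.-group (M / N) by rewrite /pgroup pnatNK.
have [b1 Res_b1 spec_b1] :=
  pi_special_extension hallK nsMG nsNG sNM pi''MN spec_b.
have [_ IGa _ _] := spec_a; have [_ IGb1 _ _] := spec_b1.
have IMa := subset_trans sMG IGa.
have [mul_irr mul_inj mul_Ind _] := constt_Ind_mul_ext nsNM Res_b1 IMa irr_ab.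
have : c \in irr_constt ('Ind[M] ('chi_a * 'chi_b)).
  by rewrite irr_consttE cfdotC conjC_eq0 -cfdot_Res_l.
rewrite mul_Ind => /imageP[a1 a1M Dc].
have {}Dc : 'chi_c = 'chi_a1 * 'chi_b1 by rewrite Dc cfIirrE ?mul_irr.
exists (a1, b1); split=> //=.
apply: (pi_special_constt_Ind hallH nsMG nsNM piMN spec_a a1M).
apply/subsetP=> g Gg; rewrite inE (subsetP nMG) //=; apply/eqP.
rewrite -conjg_IirrE; congr ('chi_ _).
have a1gM : conjg_Iirr a1 g \in irr_constt ('Ind[M] 'chi_a).
  rewrite irr_consttE conjg_IirrE -(inertiaJ (subsetP IGa g Gg)).
  by rewrite -(cfConjgInd _ nsMG nsNG Gg) cfConjg_iso.
apply: mul_inj => //; apply: irr_inj.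
rewrite (cfIirrE (mul_irr _ a1gM)) (cfIirrE (mul_irr _ a1M)) conjg_IirrE.
rewrite -Dc -(inertiaJ (subsetP IGb1 g Gg)) -rmorphM /= -Dc.
exact: inertiaJ (subsetP IGc g Gg).
Qed.

End PiSpecial.

(** * Subgroups and Hall subgroups of p-solvable groups *)

Section PSolvable.

Variables (p : nat) (gT : finGroupType).
Implicit Types G H K M N P T : {group gT}.

(** The condition on consecutive terms in [p_solvable], under a name. *)
Definition p_step : rel {group gT} :=
  fun H K => (H \subset K) && (p.-group (K / H) || p^'.-group (K / H)).

Lemma p_solvableS G T : T \subset G -> p_solvable p G -> p_solvable p T.
Proof.
move=> sTG [s [nsG path_s last_s]].
pose f N : {group gT} := (T :&: N)%G.
have f1 : f 1%G = 1%G by apply: val_inj; rewrite /= setIC; apply/setIidPl/sub1G.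
exists (map f s); split.
- apply/allP=> _ /mapP[N Ns ->] /=.
  exact: normalGI sTG (allP nsG N Ns).
- rewrite -f1; move: nsG path_s; have ns1 : 1%G <| G := normal1 G.
  elim: s (1%G : {group gT}) ns1 {last_s f1} => //= M s IHs N nsNG.
  case/andP=> nsMG nsG /andP[/andP[sNM piMN] path_s].
  rewrite IHs // andbT /= setIS //=.
  have nNTM : T :&: M \subset 'N(N).
    by rewrite (subset_trans _ (normal_norm nsNG)) // subIset ?sTG.
  have eqN : T :&: M :&: N = T :&: N by rewrite -setIA (setIidPr sNM).
  have card_eq : #|(T :&: M) / (T :&: N)|%g = #|(T :&: M) / N|%g.
    by rewrite -eqN setIC; apply/card_isog/second_isog.
  rewrite /pgroup card_eq -!/(pgroup _ _).
  case/orP: piMN => piMN; rewrite (pgroupS _ piMN) ?orbT //;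
    by rewrite quotientS ?subsetIr.
- rewrite -f1 last_map last_s; apply: val_inj; exact/setIidPl.
Qed.

(** K is built downwards from G.  Below M, a p'-factor M / N leaves K unchanged,
    while a p-factor M / N is a normal Hall subgroup of K / N, which splits by
    the Schur-Zassenhaus theorem; K is then replaced by the preimage of a
    complement. *)
Lemma p'Hall_above s N G :
    N <| G -> all (fun M : {group gT} => M <| G) s -> path p_step N s ->
    last N s = G ->
  exists K, [/\ N \subset K, K \subset G, p^'.-nat #|K : N| & p.-nat #|G : K|].
Proof.
elim: s N => [|M s IHs] N nsNG /=.
  by move=> _ _ <-; exists N; rewrite indexgg.
case/andP=> nsMG nsG /andP[/andP[sNM piMN] path_s] last_s.
have [K [sMK sKG p'KM pGK]] := IHs M nsMG nsG path_s last_s.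
have sNK := subset_trans sNM sMK.
have nNK : K \subset 'N(N) := subset_trans sKG (normal_norm nsNG).
have nsNM : N <| M by rewrite /normal sNM (subset_trans sMK).
case/orP: piMN => [pMN | p'MN]; last first.
  exists K; split=> //; rewrite -(Lagrange_index sMK sNM) pnatM p'KM.
  by rewrite -card_quotient ?normal_norm.
have nsMK : M <| K := normalS sMK sKG nsMG.
have nsNK : N <| K := normalS sNK sKG nsNG.
have hallMN : Hall (K / N) (M / N).
  rewrite /Hall quotientS //= -divgS ?quotientS //.
  rewrite !card_quotient ?normal_norm //.
  rewrite -(Lagrange_index sMK sNM) mulnK ?indexg_gt0 //.
  by rewrite (pnat_coprime (pi := p)) // -card_quotient // normal_norm.
have /splitsP[B /complP[tiMB defK]] :=
  SchurZassenhaus_split hallMN (quotient_normal N nsMK).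
have sBK : B \subset (K / N)%g by rewrite -defK mulG_subr.
pose L := (coset N @*^-1 B)%G; have DB : (L / N = B)%g by rewrite cosetpreK.
have sNL : N \subset L by apply: sub_cosetpre.
have sLK : L \subset K by rewrite -(quotientGK nsNK) /= morphpreS.
have cardB : (#|B| * #|M : N| = #|K : N|)%N.
  rewrite -!card_quotient ?normal_norm // -defK mulnC TI_cardMg //.
have iLN : #|L : N| = #|B|.
  by rewrite -DB card_quotient // (subset_trans sLK).
have iKM : #|K : M| = #|B|.
  apply/eqP; rewrite -(eqn_pmul2r (indexg_gt0 M N)) cardB.
  by rewrite Lagrange_index.
exists L; split=> //; first exact: subset_trans sLK sKG.
  by rewrite iLN -iKM.
rewrite -(Lagrange_index sKG sLK) pnatM pGK.
suffices -> : #|K : L| = #|M : N| by rewrite -card_quotient // normal_norm.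
apply/eqP; rewrite -(eqn_pmul2r (indexg_gt0 L N)) (Lagrange_index sLK sNL).
by rewrite iLN mulnC cardB.
Qed.

Lemma p_solvable_p'Hall G : p_solvable p G -> exists K, p^'.-Hall(G) K.
Proof.
case=> s [nsG path_s last_s].
have [K [_ sKG p'K pGK]] := p'Hall_above (normal1 G) nsG path_s last_s.
exists K; rewrite /pHall sKG /pgroup -indexg1 p'K /=.
by rewrite pnatNK.
Qed.

End PSolvable.

(** * Quasi-primitive characters *)

Section QuasiPrimitive.

Variables (p : nat) (gT : finGroupType).
Implicit Types G H K M N P T : {group gT}.

Definition quasi_primitive G (chi : 'CF(G)) :=
  forall N (i : Iirr N), N <| G -> i \in irr_constt ('Res[N] chi) ->
    G \subset 'I['chi_i].

(** The invariant carried up the normal series; a scalar product expresses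
    that the product is a constituent, since it comes without an index. *)
Definition special_factors G P K (chi : 'CF(G)) N :=
  exists ab : Iirr N * Iirr N,
    [/\ pi_special p G P 'chi_ab.1, pi_special p^' G K 'chi_ab.2,
        'chi_ab.1 * 'chi_ab.2 \in irr N
      & '['Res[N] chi, 'chi_ab.1 * 'chi_ab.2] != 0].

Lemma special_factors_step G P K (c : Iirr G) M N :
    p.-Hall(G) P -> p^'.-Hall(G) K -> quasi_primitive 'chi_c ->
    N <| G -> M <| G -> p_step p N M ->
  special_factors P K 'chi_c N -> special_factors P K 'chi_c M.
Proof.
move=> hallP hallK qpc nsNG nsMG /andP[sNM piMN].
move=> [[a b] /= [spec_a spec_b irr_ab c_ab]].
have [d cMd d_ab] : exists2 d, d \in irr_constt ('Res[M] 'chi_c) &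
    '['Res[N] 'chi_d, 'chi_a * 'chi_b] != 0.
  apply/exists_inP; apply: contraR c_ab.
  rewrite negb_exists_in => /forall_inP d0.
  rewrite -(cfResRes _ sNM (normal_sub nsMG)) ['Res[M] _]cfun_sum_constt.
  rewrite linear_sum cfdot_suml big1 // => d /d0; rewrite negbK => /eqP d_ab.
  by rewrite linearZ cfdotZl d_ab mulr0.
have IGd := qpc M d nsMG cMd.
case/orP: piMN => [pMN | p'MN].
  have [[a1 b1] /= [spec_a1 spec_b1 Dd]] :=
    pi_special_factor_step hallP hallK nsMG nsNG sNM pMN
      spec_a spec_b IGd irr_ab d_ab.
  by exists (a1, b1); rewrite /= -Dd mem_irr; split.
have spec_a' : pi_special p^'^' G P 'chi_a.
  by case: spec_a => irr_a IGa; rewrite -pnatNK.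
rewrite mulrC in irr_ab d_ab.
have [[b1 a1] /= [spec_b1 spec_a1 Dd]] :=
  pi_special_factor_step hallK (pHallNK hallP) nsMG nsNG sNM p'MN
    spec_b spec_a' IGd irr_ab d_ab.
exists (a1, b1); rewrite /= mulrC -Dd mem_irr; split=> //.
exact: pi_specialNK.
Qed.

Lemma special_factorization G P K (c : Iirr G) :
    p_solvable p G -> p.-Hall(G) P -> p^'.-Hall(G) K ->
    quasi_primitive 'chi_c ->
  exists ab : Iirr G * Iirr G,
    [/\ pi_special p G P 'chi_ab.1, pi_special p^' G K 'chi_ab.2
      & 'chi_c = 'chi_ab.1 * 'chi_ab.2].
Proof.
move=> [s [nsG path_s last_s]] hallP hallK qpc.
have factors1 : special_factors P K 'chi_c 1%G.
  exists (0, 0); rewrite /= irr0 mulr1; split; try exact: pi_special_cfun1.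
    exact: cfun1_irr.
  rewrite cfdotE cards1 big_set1 cfRes1 cfun11 conjC1 mulr1 invr1 mul1r.
  exact: irr1_neq0.
have: special_factors P K 'chi_c (last 1%G s).
  move: nsG path_s factors1; have : 1%G <| G := normal1 G.
  elim: s (1%G : {group gT}) {last_s} => //= M s IHs N nsNG /andP[nsMG nsG].
  case/andP=> NM path_s facN; apply: IHs => //.
  exact: (special_factors_step hallP hallK qpc nsNG nsMG NM facN).
rewrite last_s => - [[a b] /= [spec_a spec_b /irrP[d Dd]]].
rewrite cfRes_id Dd cfdot_irr pnatr_eq0 eqb0 negbK => /eqP Dc.
by exists (a, b); rewrite Dc.
Qed.

(** Let L be the kernel of chi = 'chi_c and A / L a maximal normal abelian
    subgroup of G / L.  Then chi restricts to A as a multiple of one linear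
    character, so A acts by scalars and is central modulo L.  As A / L is
    self-centralizing in G / L, the latter is abelian. *)
Lemma quasi_primitive_pgroup_lin G (c : Iirr G) :
  p.-group G -> quasi_primitive 'chi_c -> 'chi_c \is a linear_char.
Proof.
move=> pG qpc; set L := cfker 'chi_c; have nsLG : L <| G := cfker_normal 'chi_c.
have [A0 maxA _] : {A : {group coset_of L} |
    [max A | A <| G / L & abelian A] & 1%G \subset A}.
  by apply: maxgroup_exists; rewrite normal1 abelian1.
have SCN_A := max_SCN (quotient_pgroup L pG) maxA.
have [nsA cA] := SCN_P SCN_A; have abA := SCN_abelian SCN_A.
pose A := (coset L @*^-1 A0)%G; have DA : (A / L = A0)%g by rewrite cosetpreK.
have nsAG : A <| G by rewrite -(quotientGK nsLG) cosetpre_normal.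
have sAG := normal_sub nsAG.
have sLA : L \subset A by apply: sub_cosetpre.
have nLA : A \subset 'N(L) := subset_trans sAG (normal_norm nsLG).
have A'L : (A^`(1) \subset L)%g by rewrite der1_min // DA.
have [i Ai] := constt_cfRes_irr A c.
have lin_i : 'chi_i \is a linear_char.
  rewrite lin_irr_der1 (subset_trans A'L) //.
  apply: subset_trans (cfker_constt (cfRes_char _ (irr_char c)) Ai).
  by rewrite cfker_Res ?irr_char // subsetI sLA subxx.
have sAZ : A \subset 'Z('chi_c)%CF.
  apply/subsetP=> x Ax; rewrite irr_cfcenterE ?(subsetP sAG) //.
  rewrite -(cfResE 'chi_c sAG Ax) -(cfRes1 A).
  rewrite (Res_invariant_constt nsAG (qpc _ _ nsAG Ai) Ai).
  rewrite !cfunE normrM normC_lin_char // lin_char1 // !mulr1 ger0_norm //.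
  by rewrite natr_ge0 ?Cnat_cfdot_char_irr ?cfRes_char ?irr_char.
rewrite lin_irr_der1 der1_min ?normal_norm //.
have sA0Z : A0 \subset 'Z(G / L)%g by rewrite -cfcenter_eq_center -DA quotientS.
have DG : 'C_(G / L)(A0) = (G / L)%g.
  by apply/setIidPl; rewrite centsC (subset_trans sA0Z) ?subsetIr.
by rewrite -DG cA.
Qed.

Lemma lin_constt_of_p'deg G (phi : 'CF(G)) :
    prime p -> p.-group G -> phi \is a character ->
    p^'.-nat (Num.truncn (phi 1%g)) ->
  exists2 i, i \in irr_constt phi & 'chi[G]_i \is a linear_char.
Proof.
move=> p_pr pG Nphi p'phi1.
apply/exists_inP; apply: contraLR p'phi1.
rewrite negb_exists_in => /forall_inP nonlin.
have : (p %| phi 1%g)%C.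
  rewrite [phi]cfun_sum_constt sum_cfunE.
  apply: rpred_sum => i /nonlin nlin_i; rewrite cfunE.
  rewrite dvdC_mull ?intr_nat ?Cnat_cfdot_char_irr //.
  have := irr1_pnat pG (mem_irr i).
  rewrite irr1_degree natrK dvdC_nat => /p_natP[[|k] Dk]; last first.
    by rewrite Dk expnS dvdn_mulr.
  by case/negP: nlin_i; rewrite qualifE /= irr_char irr1_degree Dk expn0 eqxx.
rewrite -(truncnK (Cnat_char1 Nphi)) dvdC_nat => p_dv_phi1.
by rewrite natrK p'natE ?p_dv_phi1.
Qed.

End QuasiPrimitive.

(** * Monomial summands *)

Section MonomialSummand.

Variables (p : nat) (gT : finGroupType).
Implicit Types G H K M N P T : {group gT}.

Definition monomial_summand P G (chi : 'CF(G)) :=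
  exists (Q : {group gT}) (lambda : 'CF(Q)),
    [/\ Q \subset P, lambda \is a linear_char,
        ((Num.truncn (chi 1%g))`_p)%N = #|P : Q|
      & 'Res[P] chi - 'Ind[P] lambda \is a character].

(** A Sylow p-subgroup of the inertia group of 'chi_t lies in a conjugate of
    P; conjugating 'chi_t back moves it inside P. *)
Lemma Clifford_Sylow_reduction G P N (c : Iirr G) (t : Iirr N) :
    p.-Sylow(G) P -> N <| G -> t \in irr_constt ('Res[N] 'chi_c) ->
    ~~ (G \subset 'I['chi_t]) ->
  exists (T : {group gT}) (s : Iirr T),
    [/\ T \proper G, p.-Sylow(T) (P :&: T) & 'chi_c = 'Ind[G] 'chi_s].
Proof.
move=> sylP nsNG ct not_IGt.
have [S sylS] := Sylow_exists p 'I_G['chi_t].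
have [sSI pS _] := and3P sylS.
have [x Gx sSPx] := Sylow_subJ sylP (subset_trans sSI (subsetIl _ _)) pS.
pose u := conjg_Iirr t x^-1; pose T := 'I_G['chi_u]%G.
have Gx' : x^-1%g \in G by rewrite groupV.
have nNx' : x^-1%g \in 'N(N) := subsetP (normal_norm nsNG) _ Gx'.
have DT : T :=: 'I_G['chi_t] :^ x^-1.
  by rewrite /= conjg_IirrE -conjg_inertia // conjIg conjGid.
have cu : u \in irr_constt ('Res[N] 'chi_c).
  by rewrite irr_consttE conjg_IirrE cfdot_Res_conjg.
have := cu; rewrite -constt_Ind_Res.
have [_ _ imT _ _] := constt_Inertia_bijection u nsNG.
rewrite -imT => /imsetP[s uTs Dc].
have [irrT _ _ _ _] := constt_Inertia_bijection u nsNG.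
exists T, s; split.
- rewrite properE subsetIl /= subsetI subxx /=; apply: contra not_IGt => IGu.
  have : G \subset T by rewrite subsetI subxx.
  by rewrite DT -{1}(conjGid Gx') conjSg subsetI subxx.
- have sylSx : p.-Sylow(T) (S :^ x^-1) by rewrite DT pHallJ2.
  have sSxPT : S :^ x^-1 \subset P :&: T.
    by rewrite subsetI (pHall_sub sylSx) sub_conjgV sSPx.
  rewrite (sub_pHall sylSx _ sSxPT) ?subsetIr //.
  by apply: pgroupS (pHall_pgroup sylP); apply: subsetIl.
by rewrite Dc cfIirrE ?irrT.
Qed.

Lemma monomial_summand_Ind G P T (s : Iirr T) (psi := 'chi_s) :
    p.-Sylow(G) P -> T \subset G -> p.-Sylow(T) (P :&: T) ->
  monomial_summand (P :&: T)%G psi -> monomial_summand P ('Ind[G] psi).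
Proof.
move=> sylP sTG sylPT [Q [lambda [sQPT lin_l deg_psi Npsi_l]]].
have [sPG _ _] := and3P sylP; have sPTP := subsetIl P T.
exists Q, lambda; split=> //; first exact: subset_trans sQPT sPTP.
  have Npsi : psi \is a character := irr_char s.
  have Dm : psi 1%g = (Num.truncn (psi 1%g))%:R by rewrite truncnK ?Cnat_char1.
  have m_gt0 : (0 < Num.truncn (psi 1%g))%N.
    by rewrite -(ltr0n algC) -Dm irr1_gt0.
  rewrite cfInd1 // Dm -natrM natrK partnM //.
  rewrite -(Lagrange_index sPTP sQPT) -deg_psi; congr (_ * _)%N.
  apply/eqP; rewrite -(eqn_pmul2l (cardG_gt0 (P :&: T))) Lagrange //.
  by rewrite (card_Hall sylPT) (card_Hall sylP) -partnM // Lagrange.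
rewrite -(cfIndInd lambda sPTP sQPT).
set A := 'Res _; set B := 'Ind[P] _.
pose C : 'CF(P) := 'Ind[P] ('Res[P :&: T] psi).
(* A - C comes from Mackey's formula, C - B from the summand of psi. *)
have -> : A - B = (A - C) + (C - B) by rewrite addrA subrK.
rewrite rpredD ?sub_Res_Ind_char ?irr_char // -raddfB cfInd_char //.
Qed.

(** The constituent is the product of a linear constituent of the p'-special
    factor with the restriction to P of the p-special factor. *)
Lemma quasi_primitive_pdegree_constt G P (c : Iirr G) :
    prime p -> p_solvable p G -> p.-Sylow(G) P -> quasi_primitive 'chi_c ->
  exists d : Iirr P, 'Res[P] 'chi_c - 'chi_d \is a character /\
    ((Num.truncn ('chi_c 1%g))`_p)%N = Num.truncn ('chi_d 1%g).
Proof.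
move=> p_pr solG sylP qpc; have [sPG pP _] := and3P sylP.
have [K hallK] := p_solvable_p'Hall solG.
have [[a b] /= [spec_a spec_b Dc]] := special_factorization solG sylP hallK qpc.
have pa1 := pi_special_deg_pnat pP spec_a.
have p'b1 := pi_special_deg_pnat (pHall_pgroup hallK) spec_b.
have [_ _ _ irr_aP] := spec_a; rewrite (setIidPl sPG) in irr_aP.
have NbP : 'Res[P] 'chi_b \is a character by rewrite cfRes_char ?irr_char.
have [|l bl lin_l] := lin_constt_of_p'deg p_pr pP NbP; first by rewrite cfRes1.
have /irrP[d Dd] := mul_lin_irr lin_l irr_aP.
exists d; split.
  have [psi Npsi Dpsi] := constt_charP l NbP bl.
  rewrite Dc rmorphM /= Dpsi -Dd mulrDr [_ * 'chi_l]mulrC addrAC subrr add0r.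
  by rewrite rpredM ?(irrWchar irr_aP).
rewrite Dc -Dd [in LHS]cfunE [in RHS]cfunE (lin_char1 lin_l) mul1r cfRes1.
move: pa1 p'b1; rewrite !irr1_degree -natrM !natrK => pa1 p'b1.
by rewrite partnM ?irr_degree_gt0 // (part_pnat_id pa1) part_p'nat ?muln1.
Qed.

Lemma p_solvable_pgroup P : p.-group P -> p_solvable p P.
Proof.
move=> pP; exists [:: P]; split=> //=; rewrite ?normal_refl //.
by rewrite sub1G quotient_pgroup.
Qed.

Lemma exists_monomial_summand G P (c : Iirr G) :
    prime p -> p_solvable p G -> p.-Sylow(G) P -> monomial_summand P 'chi_c.
Proof.
move=> p_pr; have [n] := ubnP #|G|; elim: n => // n IHn in G P c *.
move=> /ltnSE-leGn solG sylP; have [sPG pP _] := and3P sylP.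
have [/existsP[N /andP[nsNG /exists_inP[t ct not_IGt]]] | ] :=
  boolP [exists N : {group gT}, (N <| G) &&
    [exists t in irr_constt ('Res[N] 'chi_c), ~~ (G \subset 'I['chi_t])]].
  have [T [s [ltTG sylPT ->]]] := Clifford_Sylow_reduction sylP nsNG ct not_IGt.
  have sTG := proper_sub ltTG.
  apply: (monomial_summand_Ind sylP sTG sylPT).
  apply: IHn sylPT; first exact: leq_trans (proper_card ltTG) leGn.
  exact: p_solvableS solG.
rewrite negb_exists => /forallP good.
have qpc : quasi_primitive 'chi_c.
  move=> N t nsNG ct; apply: contraR (good N) => not_IGt.
  by rewrite nsNG; apply/exists_inP; exists t.
have [eqPG | ltPG] := eqVproper sPG.
  have DP : P = G by apply: val_inj.
  subst P; exists G, 'chi_c; rewrite cfRes_id cfInd_id subrr rpred0.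
  have lin_c := quasi_primitive_pgroup_lin pP qpc.
  by split; rewrite // lin_char1 // indexgg truncn1 partn1.
have [d [Nsub Dd]] := quasi_primitive_pdegree_constt p_pr solG sylP qpc.
have pP1 := irr1_pnat pP (mem_irr d).
have [||Q [lambda [sQP lin_l deg_d Nd]]] := IHn P P d _ (p_solvable_pgroup pP).
- exact: leq_trans (proper_card ltPG) leGn.
- by rewrite /pHall subxx pP indexgg.
exists Q, lambda; split=> //.
  by rewrite -deg_d Dd part_pnat_id.
rewrite cfRes_id in Nd.
by rewrite -(subrK 'chi_d ('Res[P] 'chi_c)) -addrA rpredD.
Qed.

End MonomialSummand.

Local Close Scope ring_scope.

Theorem corollary3 (p : nat) (gT : finGroupType) (G P : {group gT})
    (p_pr : prime p) (solG : p_solvable p G) (sylP : p.-Sylow(G) P)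
    (chi : 'CF(G)) (chi_irr : chi \in irr G) :
  exists (Q : {group gT}) (lambda : 'CF(Q)),
    [/\ Q \subset P,
        lambda \in irr Q,
        lambda \is a linear_char,
        ((Num.truncn (chi 1%g))`_p)%N = #|P : Q|
      & ('Res[P] chi - 'Ind[P] lambda)%R \is a character].
Proof.
have /irrP[c Dc] := chi_irr.
have [Q [lambda [sQP lin_l deg_chi Nsub]]] :=
  exists_monomial_summand c p_pr solG sylP.
by exists Q, lambda; rewrite Dc lin_char_irr.
Qed.
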